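(* For $n\ge 2$, the minimum wirelength of embedding the 3-ary $n$-cube $Q_n^3$ into the cylinder $C_3\times P_{3^{n-1}}$ is \[WL(Q_n^3, C_3\times P_{3^{n-1}})=3^{n-1}\Big(2\big(3^{n-1}-1\big)+3 \Big).\]
   Context: $Q_n^3$ is the graph on $\{0,1,2\}^n$ in which two tuples are adjacent iff they differ in exactly one coordinate $j$ and there $x_j\equiv y_j\pm1\pmod 3$. The cylinder $C_3\times P_{m}$ is the Cartesian product of the cycle $C_3$ and the path $P_m$ on $m$ vertices. An embedding of $G$ into $H$ ($|V(G)|=|V(H)|$) is a bijection $f:V(G)\to V(H)$ with a chosen path $P_f(u,v)$ in $H$ between $f(u),f(v)$ for each edge $(u,v)$ of $G$; the congestion $c_f(e)$ of $e\in E(H)$ is the number of edges of $G$ whose path contains $e$; $WL_f(G,H)=\sum_{e\in E(H)}c_f(e)$ and $WL(G,H)=\min_f WL_f(G,H)$. *)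

(* Defs.v *)
From mathcomp Require Import all_boot.

Set Implicit Arguments.
Unset Strict Implicit.
Unset Printing Implicit Defensive.

Record sgraph := SGraph {
  vertex :> finType;
  adj : rel vertex;
  adj_sym : symmetric adj;
  adj_irrefl : irreflexive adj }.

Arguments adj {s} x y.

Definition edges (G : sgraph) : {set {set G}} :=
  [set [set p.1; p.2] | p : G * G & adj p.1 p.2].

Definition cube3_adj (n : nat) (x y : {ffun 'I_n -> 'I_3}) : bool :=
  [exists j : 'I_n,
     [forall i : 'I_n, (x i != y i) == (i == j)] &&
     ((x j == y j + 1 %[mod 3]) || (x j + 1 == y j %[mod 3]))].

Lemma cube3_adj_sym n : symmetric (@cube3_adj n).
Proof.
move=> x y; apply: eq_existsb => j; congr (_ && _).
  by apply: eq_forallb => i; rewrite (eq_sym (x i)).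
by rewrite orbC; congr (_ || _); rewrite eq_sym.
Qed.

Lemma cube3_adj_irrefl n : irreflexive (@cube3_adj n).
Proof.
move=> x; apply/existsP => -[j /andP[/forallP /(_ j)]].
by rewrite !eqxx.
Qed.

Definition cube3 (n : nat) : sgraph :=
  SGraph (@cube3_adj_sym n) (@cube3_adj_irrefl n).

(* The conjunct [i != j] removes the loop when [m = 1]. *)
Definition cycle_adj (m : nat) (i j : 'I_m) : bool :=
  (i != j) && ((i + 1 == j %[mod m]) || (i == j + 1 %[mod m])).

Lemma cycle_adj_sym m : symmetric (@cycle_adj m).
Proof.
move=> i j; rewrite /cycle_adj eq_sym orbC; congr (_ && (_ || _));
  exact: eq_sym.
Qed.

Lemma cycle_adj_irrefl m : irreflexive (@cycle_adj m).
Proof. by move=> i; rewrite /cycle_adj eqxx. Qed.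

Definition cycle_graph (m : nat) : sgraph :=
  SGraph (@cycle_adj_sym m) (@cycle_adj_irrefl m).

Definition path_adj (m : nat) (i j : 'I_m) : bool :=
  (i.+1 == j :> nat) || (j.+1 == i :> nat).

Lemma path_adj_sym m : symmetric (@path_adj m).
Proof. by move=> i j; rewrite /path_adj orbC. Qed.

Lemma path_adj_irrefl m : irreflexive (@path_adj m).
Proof. by move=> i; rewrite /path_adj orbb gtn_eqF. Qed.

Definition path_graph (m : nat) : sgraph :=
  SGraph (@path_adj_sym m) (@path_adj_irrefl m).

Definition cart_adj (G H : sgraph) (x y : G * H) : bool :=
  ((x.1 == y.1) && adj x.2 y.2) || ((x.2 == y.2) && adj x.1 y.1).

Lemma cart_adj_sym G H : symmetric (@cart_adj G H).
Proof.
move=> x y; rewrite /cart_adj (adj_sym x.1) (adj_sym x.2).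
by rewrite (eq_sym x.1) (eq_sym x.2).
Qed.

Lemma cart_adj_irrefl G H : irreflexive (@cart_adj G H).
Proof. by move=> x; rewrite /cart_adj !adj_irrefl !andbF. Qed.

Definition cart_prod (G H : sgraph) : sgraph :=
  SGraph (@cart_adj_sym G H) (@cart_adj_irrefl G H).

(* Edges traversed by the vertex sequence [x :: s]. *)
Definition walk_edges (G : sgraph) (x : G) (s : seq G) : {set {set G}} :=
  [set:: pairmap (fun u v => [set u; v]) x s].

(* A path is identified with its set of edges, so that a path between [a] and
   [b] is also one between [b] and [a]. *)
Definition path_between (G : sgraph) (a b : G) (A : {set {set G}}) : Prop :=
  exists s : seq G,
    [/\ path adj a s, last a s = b, uniq (a :: s) & A = walk_edges a s].

Record embedding (G H : sgraph) := Embedding {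
  emb_map : G -> H;
  emb_path : {set G} -> {set {set H}};
  emb_bij : bijective emb_map;
  emb_pathP : forall u v : G, adj u v ->
    path_between (emb_map u) (emb_map v) (emb_path [set u; v]) }.

Definition congestion (G H : sgraph) (f : embedding G H) (e : {set H}) : nat :=
  #|[set d in edges G | e \in emb_path f d]|.

Definition wirelength (G H : sgraph) (f : embedding G H) : nat :=
  \sum_(e in edges H) congestion f e.

(* WL(G, H) = w, the minimum being attained. *)
Definition min_wirelength_is (G H : sgraph) (w : nat) : Prop :=
  (exists f : embedding G H, wirelength f = w) /\
  (forall f : embedding G H, w <= wirelength f).

(* Main.v *)
Require Import Defs.
From mathcomp Require Import all_boot zify.

Set Implicit Arguments.
Unset Strict Implicit.
Unset Printing Implicit Defensive.

(** The wirelength is the sum of the lengths of the chosen paths, hence at least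
    the sum over the cube edges of the cylinder distance between the images.
    That distance counts the row cuts separating the two images, plus one if
    their columns differ.  Summing over the cuts, the problem becomes bounding
    from below the edge boundary, in the ternary cube, of sets of size [3 k]
    (the first [k] rows) and [3 ^ (n - 1)] (a column).  As C_3 = K_3, Lindsey's
    theorem gives the sharp bound, realised by lexicographic initial segments;
    its numerical core is a superadditivity property of the sum of base-3 digit
    sums.  All the bounds are attained at once by sending [x] to column [x_0]
    and to the row with base-3 digits [x_1, ..., x_(n-1)], and routing along
    geodesics. *)

(** * Sums of base-3 digit sums *)

(** Stopping at position [i] loses no digit, because [i < 3 ^ i]. *)
Definition digit_sum3 (i : nat) : nat := \sum_(j < i) (i %/ 3 ^ j) %% 3.

Lemma digit_sum3_wide (N i : nat) :
  i <= N -> digit_sum3 i = \sum_(j < N) (i %/ 3 ^ j) %% 3.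
Proof.
move=> le_iN; rewrite /digit_sum3 -!(big_mkord xpredT (fun j => (i %/ 3 ^ j) %% 3)).
rewrite (big_cat_nat (leq0n i) le_iN) //= [X in _ + X]big1_seq ?addn0 // => j.
rewrite mem_index_iota => /andP[_ /andP[le_ij _]].
by rewrite divn_small // (leq_trans (ltn_expl i (isT : 1 < 3))) ?leq_exp2l.
Qed.

Lemma digit_sum3_rec (k r : nat) :
  r < 3 -> digit_sum3 (3 * k + r) = digit_sum3 k + r.
Proof.
move=> lt_r3; rewrite (@digit_sum3_wide (3 * k + r).+1) // big_ord_recl /=.
rewrite expn0 divn1 (mulnC 3) modnMDl modn_small // addnC; congr (_ + _).
rewrite (@digit_sum3_wide (k * 3 + r) k); last by lia.
apply: eq_bigr => j _; rewrite /bump /= add1n expnS divnMA divnMDl //.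
by rewrite (divn_small lt_r3) addn0.
Qed.

(* The number of edges of the ternary cube inside the lexicographically first
   [n] vertices. *)
Definition lex_edges (n : nat) : nat := \sum_(i < n) digit_sum3 i.

Lemma lex_edgesS (n : nat) : lex_edges n.+1 = lex_edges n + digit_sum3 n.
Proof. by rewrite /lex_edges big_ord_recr. Qed.

Lemma lex_edges0 : lex_edges 0 = 0.
Proof. exact: big_ord0. Qed.

Lemma lex_edges1 : lex_edges 1 = 0.
Proof. by rewrite lex_edgesS lex_edges0 /digit_sum3 big_ord0. Qed.

(** Grouping by last digit gives three shorter initial segments; each full triple of numbers sharing
    the higher digits adds a triangle and, in the variants below, a leftover pair adds one edge. *)
Lemma lex_edges_mul3 (k : nat) :
  lex_edges (3 * k) = 3 * lex_edges k + 3 * k.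
Proof.
elim: k => [|k IHk]; first by rewrite muln0 lex_edges0.
have -> : 3 * k.+1 = (3 * k).+3 by lia.
move: (digit_sum3_rec k (isT : 0 < 3)) (digit_sum3_rec k (isT : 1 < 3)).
move: (digit_sum3_rec k (isT : 2 < 3)); rewrite addn2 addn1 !addn0 => s2 s0 s1.
by rewrite !lex_edgesS IHk s0 s1 s2; lia.
Qed.

Lemma lex_edges_mul3S (k : nat) :
  lex_edges (3 * k).+1 = 2 * lex_edges k + lex_edges k.+1 + 3 * k.
Proof.
rewrite !lex_edgesS lex_edges_mul3.
by move: (digit_sum3_rec k (isT : 0 < 3)); rewrite !addn0 => ->; lia.
Qed.

Lemma lex_edges_mul3SS (k : nat) :
  lex_edges (3 * k).+2 = lex_edges k + 2 * lex_edges k.+1 + (3 * k).+1.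
Proof.
rewrite lex_edgesS lex_edges_mul3S lex_edgesS.
by move: (digit_sum3_rec k (isT : 1 < 3)); rewrite addn1 => ->; lia.
Qed.

Lemma lex_edges_exp3 (p : nat) : lex_edges (3 ^ p) = p * 3 ^ p.
Proof.
elim: p => [|p IHp]; first by rewrite lex_edges1.
by rewrite expnS lex_edges_mul3 IHp; lia.
Qed.

Lemma sum_mul3 (F : nat -> nat) (k : nat) :
  \sum_(i < 3 * k) F i =
  \sum_(i < k) (F (3 * i) + F (3 * i).+1 + F (3 * i).+2).
Proof.
elim: k => [|k IHk]; first by rewrite muln0 !big_ord0.
have -> : 3 * k.+1 = (3 * k).+3 by lia.
by rewrite !big_ord_recr /= IHk !addnA.
Qed.

(** Evaluates in closed form the total of the isoperimetric bounds over all row cuts, the [k]-th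
    being [6 * p * k - 6 * lex_edges k]. *)
Lemma sum_lex_edges_exp3 (p : nat) :
  3 * p * (\sum_(k < 3 ^ p) k) =
  3 * (\sum_(k < 3 ^ p) lex_edges k) + 3 ^ p * (3 ^ p - 1).
Proof.
have sum_id m : 2 * (\sum_(k < m) k) = m * (m - 1).
  elim: m => [|m IHm]; first by rewrite big_ord0.
  by rewrite big_ord_recr /= mulnDr IHm; nia.
have sum_succ m : \sum_(k < m) lex_edges k.+1 =
    \sum_(k < m) lex_edges k + lex_edges m.
  elim: m => [|m IHm]; first by rewrite !big_ord0 lex_edges0.
  by rewrite !big_ord_recr /= IHm.
elim: p => [|p IHp]; first by rewrite expn0 !big_ord1 lex_edges0.
rewrite expnS; set m := 3 ^ p in IHp *.
have -> : \sum_(i < 3 * m) lex_edges i =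
   6 * (\sum_(i < m) lex_edges i) + 3 * (\sum_(i < m) lex_edges i.+1) +
   9 * (\sum_(i < m) i) + \sum_(i < m) 1.
  rewrite sum_mul3 !big_distrr /= -!big_split /=; apply: eq_bigr => i _.
  by rewrite lex_edges_mul3 lex_edges_mul3S lex_edges_mul3SS; lia.
rewrite sum1_card card_ord sum_succ lex_edges_exp3 -/m.
have := sum_id m; have := sum_id (3 * m).
have : 0 < m by rewrite expn_gt0.
move: (\sum_(k < m) k) (\sum_(k < m) lex_edges k) (\sum_(k < 3 * m) k) IHp.
by move=> s t u IHp m_gt0 Hu Hs; nia.
Qed.

(* Splitting [a], [b] and [c] into near-equal thirds, with the surpluses
   distributed cyclically over the three parts, makes the parts of [a + b + c]
   near-equal too, where [lex_edges] satisfies the inequality with equality. *)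
Lemma lex_edges_superadd (a b c : nat) :
  lex_edges a + lex_edges b + lex_edges c + minn a b + minn b c + minn a c
    <= lex_edges (a + b + c).
Proof.
have [N] := ubnP (a + b + c); elim: N => // N IHN in a b c *.
rewrite ltnS => leN.
(* A total of 1 has a third equal to itself, so the induction starts at 2. *)
have [small | big] := leqP (a + b + c) 1.
  case: a b c small {IHN leN} => [|[|a]] [|[|b]] [|[|c]] //= _;
    by rewrite ?lex_edges0 ?lex_edges1.
(* The parts [k + (r + t) %/ 3], for [t] equal to 2, 1, 0, are the near-equal thirds of [x];
   [3 * k + (r == 2)] counts the edges between them. *)
have thirds x : exists k r, [/\ x = 3 * k + r, r < 3 & lex_edges x =
    lex_edges (k + (r + 2) %/ 3) + lex_edges (k + (r + 1) %/ 3) +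
    lex_edges (k + r %/ 3) + 3 * k + (r == 2)].
  exists (x %/ 3), (x %% 3); split; rewrite ?ltn_pmod // {1}(divn_eq x 3) 1?mulnC //.
  case: (x %% 3) (ltn_pmod x (isT : 0 < 3)) => [|[|[|//]]] _;
    rewrite /= ?addn0 ?addn1 ?addn2.
  - by rewrite lex_edges_mul3; lia.
  - by rewrite lex_edges_mul3S; lia.
  - by rewrite lex_edges_mul3SS; lia.
have [x [i [Ha lti Ea]]] := thirds a; have [y [j [Hb ltj Eb]]] := thirds b.
have [z [l [Hc ltl Ec]]] := thirds c.
(* Each [t] selects one third of each number; the increments telescope, so these thirds add up to
   the [t]-th third of [a + b + c]. *)
have {}IHN t : t < 3 ->
  let a' := x + (i + t) %/ 3 in
  let b' := y + ((i + j + t) %/ 3 - (i + t) %/ 3) in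
  let c' := z + ((i + j + l + t) %/ 3 - (i + j + t) %/ 3) in
  lex_edges a' + lex_edges b' + lex_edges c' +
    minn a' b' + minn b' c' + minn a' c' <=
  lex_edges (x + y + z + (i + j + l + t) %/ 3).
  move=> lt3 /=; set a' := x + _; set b' := y + _; set c' := z + _.
  have -> : x + y + z + (i + j + l + t) %/ 3 = a' + b' + c' by lia.
  by apply: IHN; lia.
have [w [r [Hw ltr Ew]]] := thirds (a + b + c).
have {Hw ltr}[Hw Hr] : w = x + y + z + (i + j + l) %/ 3 /\ r = (i + j + l) %% 3.
  by split; lia.
move: (IHN 0 isT) (IHN 1 isT) (IHN 2 isT); rewrite Ea Eb Ec Ew {}Hw {}Hr Ha Hb Hc.
case: i j l lti ltj ltl {Ha Hb Hc Ea Eb Ec IHN Ew leN big}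
  => [|[|[|//]]] [|[|[|//]]] [|[|[|//]]] _ _ _ /=.
all: rewrite ?addn0 ?addn1 ?addn2 ?addn3.
all: lia.
Qed.

(** * Wirelength as a sum of path lengths *)

(** In the absence of loops, exactly two ordered pairs lie over each edge. *)
Lemma sum_adj_edges (G : sgraph) (F : {set G} -> nat) :
  \sum_(u : G) \sum_(v | adj u v) F [set u; v] = 2 * \sum_(d in edges G) F d.
Proof.
rewrite pair_big_dep /= (partition_big (fun p => [set p.1; p.2]) [in edges G]) /=;
  last by move=> p adj_p; apply/imsetP; exists p; rewrite ?inE.
rewrite big_distrr; apply: eq_bigr => d /imsetP[[u v]].
rewrite inE /= => adj_uv ->.
rewrite (eq_bigl [in [set (u, v); (v, u)]]) => [|[u' v']].
  rewrite big_setU1 ?big_set1 /=.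
    by rewrite setUC mul2n addnn.
  by rewrite inE xpair_eqE; apply: contraL adj_uv => /andP[/eqP-> _]; rewrite adj_irrefl.
rewrite !inE !xpair_eqE /=; apply/andP/orP => [[adj_uv' /eqP eq_uv]|].
  have: (u' \in [set u; v]) && (v' \in [set u; v]) by rewrite -eq_uv !inE !eqxx orbT.
  rewrite !inE => /andP[/orP[]/eqP Eu /orP[]/eqP Ev]; subst u' v';
    rewrite ?adj_irrefl // in adj_uv'; rewrite !eqxx; [by left | by right].
by case=> /andP[/eqP-> /eqP->]; rewrite ?eqxx // adj_sym setUC eqxx.
Qed.

(** The first edge contains [a], which no later edge does. *)
Lemma pairmap_edges_uniq (G : sgraph) (a : G) (s : seq G) :
  uniq (a :: s) -> uniq (pairmap (fun u v => [set u; v]) a s).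
Proof.
elim: s a => //= b s IHs a /andP[aNbs /[dup] /andP[_ _] uniq_bs].
rewrite IHs // andbT; apply: contra aNbs => /(nthP set0)[i].
rewrite size_pairmap => lt_is; rewrite (nth_pairmap a) // => /setP/(_ a).
rewrite in_set2 in_set2 eqxx /= => /orP[]/eqP E; rewrite [X in X \in _]E.
  by rewrite mem_nth //= ltnW.
by rewrite inE mem_nth ?orbT.
Qed.

Lemma card_walk_edges (G : sgraph) (a : G) (s : seq G) :
  uniq (a :: s) -> #|walk_edges a s| = size s.
Proof.
move=> /pairmap_edges_uniq/card_uniqP card_s.
by rewrite cardsE card_s size_pairmap.
Qed.

Lemma walk_edges_sub (G : sgraph) (a : G) (s : seq G) :
  path adj a s -> walk_edges a s \subset edges G.
Proof.
move=> path_s; apply/subsetP => e; rewrite inE.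
elim: s a path_s => //= b s IHs a /andP[adj_ab path_s].
rewrite inE => /orP[/eqP->|]; last exact: IHs.
by apply/imsetP; exists (a, b); rewrite ?inE.
Qed.

Lemma path_between_sym (G : sgraph) (a b : G) (A : {set {set G}}) :
  path_between a b A -> path_between b a A.
Proof.
case=> s [path_s last_s uniq_s ->]; exists (rev (belast a s)).
rewrite -last_s; split.
- by rewrite rev_path; under eq_path => u v do rewrite /= adj_sym.
- by case: s {path_s last_s uniq_s} => //= x s; rewrite rev_cons last_rcons.
- by rewrite -rev_rcons -lastI rev_uniq.
- rewrite /walk_edges; apply/setP => e; rewrite !inE.
  suff -> : pairmap (fun u v => [set u; v]) (last a s) (rev (belast a s)) =
      rev (pairmap (fun u v => [set u; v]) a s) by rewrite mem_rev.
  elim: s a {path_s last_s uniq_s} => //= x s IHs a.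
  rewrite !rev_cons -cats1 pairmap_cat IHs cats1 /=; congr rcons.
  rewrite setUC; congr ([set _; _]).
  by case: s {IHs} => //= y s; rewrite rev_cons last_rcons.
Qed.

(** Double counting of the pairs formed by an edge of [G] and an edge of [H] on its path. *)
Lemma wirelengthE (G H : sgraph) (f : embedding G H) :
  wirelength f = \sum_(d in edges G) #|emb_path f d|.
Proof.
rewrite /wirelength /congestion.
under eq_bigr => e _ do rewrite -sum1_card big_mkcond.
rewrite exchange_big [RHS]big_mkcond; apply: eq_bigr => d _.
rewrite (eq_bigr (fun e => nat_of_bool ((d \in edges G) && (e \in emb_path f d))));
  last by move=> e _; rewrite inE; case: ifP.
case: ifP => d_edge /=; last by rewrite big1.
rewrite -big_mkcondr /= -sum1_card; apply: eq_bigl => e.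
apply: andb_idl => e_d; move: d_edge => /imsetP[[u v]].
rewrite inE /= => adj_uv def_d; rewrite def_d in e_d.
have [s [path_s _ _ def_A]] := emb_pathP f adj_uv.
by rewrite (subsetP (walk_edges_sub path_s)) // -def_A.
Qed.

Lemma card_emb_path (G H : sgraph) (f : embedding G H) (u v : G) :
  adj u v -> exists s, [/\ path adj (emb_map f u) s,
    last (emb_map f u) s = emb_map f v & #|emb_path f [set u; v]| = size s].
Proof.
move=> /(emb_pathP f)[s [path_s last_s uniq_s ->]]; exists s.
by rewrite card_walk_edges.
Qed.

(* Finite choice of one path per edge; it need only be made on unordered pairs. *)
Lemma embedding_exists (G H : sgraph) (f : G -> H) (len : G -> G -> nat) :
  bijective f -> (forall u v, len u v = len v u) ->
  (forall u v, adj u v -> exists s, [/\ path adj (f u) s, last (f u) s = f v,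
     uniq (f u :: s) & size s = len u v]) ->
  exists phi : embedding G H, forall u v, adj u v ->
    #|emb_path phi [set u; v]| = len u v.
Proof.
move=> bij_f len_sym paths.
have /fin_all_exists[P PP] : forall d : {set G}, exists A : {set {set H}},
    forall u v, adj u v -> d = [set u; v] ->
      path_between (f u) (f v) A /\ #|A| = len u v.
  move=> d; have [/imsetP[[u v]]|dN] := boolP (d \in edges G); last first.
    (* Default value for a set that is not an edge. *)
    exists set0 => u v adj_uv def_d; case/negP: dN.
    by apply/imsetP; exists (u, v); rewrite ?inE.
  rewrite inE /= => adj_uv ->; have [s [path_s last_s uniq_s size_s]] := paths _ _ adj_uv.
  exists (walk_edges (f u) s) => u' v' adj_uv' eq_uv.
  have path_uv : path_between (f u) (f v) (walk_edges (f u) s) by exists s.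
  rewrite card_walk_edges // size_s.
  (* The path chosen from [u] to [v] must also serve the reversed pair. *)
  have: (u' \in [set u; v]) && (v' \in [set u; v]) by rewrite eq_uv !inE !eqxx orbT.
  rewrite !inE => /andP[/orP[]/eqP Eu /orP[]/eqP Ev]; subst u' v';
    rewrite ?adj_irrefl // in adj_uv'.
  by split; [exact: path_between_sym | rewrite len_sym].
exists (Embedding bij_f (fun u v adj_uv => proj1 (PP _ u v adj_uv erefl))).
by move=> u v adj_uv; have [] := PP _ u v adj_uv erefl.
Qed.

(** * Distance in the cylinder *)

Local Notation cylinder m := (cart_prod (cycle_graph 3) (path_graph m)).

(** The graph distance of the cylinder: any two columns are adjacent, as C_3 is complete, and at
    least one of the truncated row differences is zero. *)
Definition cyl_dist (m : nat) (a b : 'I_3 * 'I_m) : nat :=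
  (a.1 != b.1) + ((a.2 - b.2) + (b.2 - a.2)).

Lemma cycle3_adjE (i j : 'I_3) : cycle_adj i j = (i != j).
Proof. by case: i j => [[|[|[|]]] //= ?] [[|[|[|]]] //= ?]. Qed.

Lemma cyl_adjE (m : nat) (a b : 'I_3 * 'I_m) :
  adj (a : cylinder m) b =
  ((a.1 == b.1) && path_adj a.2 b.2) || ((a.2 == b.2) && (a.1 != b.1)).
Proof. by rewrite -cycle3_adjE. Qed.

Lemma cyl_dist_adj (m : nat) (a b c : 'I_3 * 'I_m) :
  adj (a : cylinder m) b -> cyl_dist a c <= (cyl_dist b c).+1.
Proof.
case: a b c => [ac ar] [bc br] [cc cr]; rewrite cyl_adjE /cyl_dist /path_adj /=.
case/orP=> /andP[/eqP-> H]; first by move: (_ != _); lia.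
by move: (ac != cc) (bc != cc) => [] []; lia.
Qed.

Lemma cyl_dist_path (m : nat) (a : cylinder m) (s : seq (cylinder m)) :
  path adj a s -> cyl_dist a (last a s) <= size s.
Proof.
elim: s a => [|b s IHs] a /=; first by rewrite /cyl_dist eqxx; lia.
move=> /andP[adj_ab /IHs dist_b].
exact: leq_trans (cyl_dist_adj (last b s) adj_ab) _.
Qed.

(** The step changes the row until the rows agree, then the column. *)
Lemma cyl_dist_step (m : nat) (a b : 'I_3 * 'I_m) :
  0 < cyl_dist a b ->
  exists2 a' : 'I_3 * 'I_m, adj (a : cylinder m) a' & (cyl_dist a' b).+1 = cyl_dist a b.
Proof.
case: a b => [ac ar] [bc br]; rewrite /cyl_dist /= => pos.
have [lt_ab | lt_ba | eq_ab] := ltngtP ar br.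
- have lt_m : ar.+1 < m by apply: leq_trans (ltn_ord br).
  exists (ac, Ordinal lt_m); first by apply: etrans (cyl_adjE _ _) _; rewrite /path_adj /= !eqxx.
  by rewrite /=; lia.
- have lt_m : ar.-1 < m by rewrite (leq_ltn_trans (leq_pred _)).
  exists (ac, Ordinal lt_m); last by rewrite /=; lia.
  by apply: etrans (cyl_adjE _ _) _; rewrite /path_adj /= eqxx; lia.
- move: pos; have [_ | neq _] := eqVneq ac bc; first lia.
  exists (bc, ar); first by apply: etrans (cyl_adjE _ _) _; rewrite /= eqxx neq orbT.
  by rewrite /= eqxx.
Qed.

Lemma cyl_geodesic (m : nat) (a b : cylinder m) :
  exists s, [/\ path adj a s, last a s = b, uniq (a :: s)
    & size s = cyl_dist a b].
Proof.
(* Strengthened claim: every later vertex is closer to [b] than [a] is, so the walk cannot return to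
   [a]. *)
suff [s [? ? ? ? _]] : exists s, [/\ path adj a s, last a s = b, uniq (a :: s),
    size s = cyl_dist a b & all (fun x => cyl_dist x b < cyl_dist a b) s].
  by exists s.
have [d def_d] : exists d, cyl_dist a b = d by eexists.
elim: d a def_d => [|d IHd] a def_d.
  exists [::]; split=> //=; case: a b def_d => [ac ar] [bc br].
  rewrite /cyl_dist /=; case: eqP => [->|_] // H.
  by congr (_, _); apply: val_inj => /=; lia.
suff [a' adj_a def_d'] : exists2 a' : cylinder m, adj a a' & cyl_dist a' b = d.
  have [s [path_s last_s uniq_s size_s all_s]] := IHd a' def_d'.
  rewrite def_d' in size_s all_s.
  have all_s' : all (fun x => cyl_dist x b < d.+1) (a' :: s).
    by rewrite /= def_d' ltnSn; apply: sub_all all_s => x; apply: ltnW.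
  exists (a' :: s); rewrite def_d; split=> //=.
  - by apply/andP.
  - rewrite -[_ && uniq s]/(uniq (a' :: s)) uniq_s andbT; apply/negP => /(allP all_s').
    by rewrite def_d ltnn.
  - by rewrite size_s.
have [|a' adj_a def_d'] := @cyl_dist_step m a b; first by rewrite def_d.
by exists a' => //; apply: succn_inj; rewrite def_d' def_d.
Qed.

Lemma wirelength_adj (G H : sgraph) (f : embedding G H) :
  2 * wirelength f = \sum_(u : G) \sum_(v | adj u v) #|emb_path f [set u; v]|.
Proof. by rewrite wirelengthE -sum_adj_edges. Qed.

Lemma wirelength_cyl_ge (G : sgraph) (m : nat) (f : embedding G (cylinder m)) :
  \sum_(u : G) \sum_(v | adj u v) cyl_dist (emb_map f u) (emb_map f v)
    <= 2 * wirelength f.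
Proof.
rewrite wirelength_adj; apply: leq_sum => u _; apply: leq_sum => v.
move=> /(card_emb_path f)[s [path_s <- ->]]; exact: cyl_dist_path.
Qed.

Lemma wirelength_cyl_attained (G : sgraph) (m : nat) (f : G -> cylinder m) :
  bijective f -> exists phi : embedding G (cylinder m),
  2 * wirelength phi = \sum_(u : G) \sum_(v | adj u v) cyl_dist (f u) (f v).
Proof.
move=> /(embedding_exists (len := fun u v => cyl_dist (f u) (f v)))[].
- by move=> u v; rewrite /cyl_dist eq_sym; lia.
- by move=> u v _; exact: cyl_geodesic.
move=> phi Hphi; exists phi; rewrite wirelength_adj.
by apply: eq_bigr => u _; apply: eq_bigr => v; exact: Hphi.
Qed.

(** * Edge-isoperimetry in the ternary cube *)

(** Two distinct residues modulo 3 always differ by 1 or -1, so the cube is the Hamming graph on [n]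
    ternary coordinates. *)
Lemma cube3_adjP (n : nat) (x y : {ffun 'I_n -> 'I_3}) :
  reflect (exists j, forall i, (x i != y i) = (i == j)) (cube3_adj x y).
Proof.
apply: (iffP existsP) => [[j /andP[/forallP xy _]]|[j xy]]; exists j.
  by move=> i; exact: (eqP (xy i)).
apply/andP; split; first by apply/forallP => i; rewrite xy.
move: (xy j); rewrite eqxx.
by case: (x j) (y j) => [[|[|[|]]] //= ?] [[|[|[|]]] //= ?].
Qed.

Definition ffun_upd (n : nat) (x : {ffun 'I_n -> 'I_3}) (j : 'I_n) (c : 'I_3) :
  {ffun 'I_n -> 'I_3} := [ffun i => if i == j then c else x i].

Lemma sum_cube3_adj (n : nat) (x : cube3 n) (F : cube3 n -> nat) :
  \sum_(y | adj x y) F y =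
  \sum_(j < n) \sum_(c | c != (x : {ffun _ -> _}) j) F (ffun_upd x j c).
Proof.
rewrite pair_big_dep /=.
rewrite -(big_imset (h := fun p => ffun_upd x p.1 p.2) F
            (A := [pred p | p.2 != (x : {ffun _ -> _}) p.1])) /=.
  apply: eq_bigl => y; apply/cube3_adjP/imsetP => [[j xy]|[[j c]]].
    exists (j, (y : {ffun _ -> _}) j); first by rewrite inE /= eq_sym xy eqxx.
    apply/ffunP => i; rewrite ffunE /=; have [->//|neq] := eqVneq i j.
    by apply/esym/eqP/negPn; rewrite xy.
  rewrite inE /= => neq ->; exists j => i; rewrite ffunE.
  by have [->|_] := eqVneq i j; rewrite ?eqxx // eq_sym.
move=> [j c] [j' c']; rewrite !inE /= => neq neq' /ffunP E.
have Ejj : j = j'.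
  apply/eqP/negPn/negP => neqj; move: (E j); rewrite !ffunE eqxx (negPf neqj).
  by move=> Ec; rewrite Ec eqxx in neq.
by subst j'; move: (E j); rewrite !ffunE eqxx => ->.
Qed.

Lemma sum_ord3 (F : 'I_3 -> nat) :
  \sum_c F c = F ord0 + F (@Ordinal 3 1 isT) + F (@Ordinal 3 2 isT).
Proof.
rewrite !big_ord_recl big_ord0 addn0 addnA.
by congr (_ + F _ + F _); apply: val_inj.
Qed.

Lemma sum_neq3 (a : 'I_3) : \sum_(c | c != a) 1 = 2.
Proof. by rewrite sum1_card cardC1 card_ord. Qed.

Lemma cube3_degree (n : nat) (x : cube3 n) : \sum_(y | adj x y) 1 = 2 * n.
Proof.
rewrite sum_cube3_adj; under eq_bigr => j _ do rewrite sum_neq3.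
by rewrite sum_nat_const card_ord mulnC.
Qed.

(** Ordered pairs are counted: an inner edge counts twice in [adj_count A A], a boundary edge once
    in [adj_count A (~: A)]. *)
Definition adj_count (G : sgraph) (A B : {set G}) : nat :=
  \sum_(u in A) \sum_(v in B) adj u v.

Lemma adj_countC (G : sgraph) (A B : {set G}) : adj_count A B = adj_count B A.
Proof.
rewrite /adj_count exchange_big; apply: eq_bigr => u _; apply: eq_bigr => v _.
by rewrite adj_sym.
Qed.

(** A vertex has at most one neighbour in another slice, reached by changing coordinate [j], so the
    edges between two slices form a matching. *)
Lemma adj_count_slices (n : nat) (j : 'I_n) (c c' : 'I_3) (S : {set cube3 n}) :
  c != c' ->
  let slice c := [set x in S | (x : {ffun _ -> _}) j == c] in
  adj_count (slice c) (slice c') <= minn #|slice c| #|slice c'|.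
Proof.
have half d d' : d != d' -> adj_count [set x in S | (x : {ffun _ -> _}) j == d]
    [set x in S | (x : {ffun _ -> _}) j == d'] <=
    #|[set x in S | (x : {ffun _ -> _}) j == d]|.
  move=> neq; rewrite -sum1_card; apply: leq_sum => x.
  rewrite inE => /andP[_ /eqP xj]; rewrite -big_mkcondr /= sum1dep_card.
  apply/card_le1_eqP => y z; rewrite !inE => /andP[/andP[_ /eqP yj] /cube3_adjP[i xy]].
  move=> /andP[/andP[_ /eqP zj] /cube3_adjP[i' xz]].
  have Ei : i = j by apply/esym/eqP; rewrite -xy xj yj.
  have Ei' : i' = j by apply/esym/eqP; rewrite -xz xj zj.
  subst i i'; apply/ffunP => i; have [->|neqi] := eqVneq i j; first by rewrite yj zj.
  move: (xy i) (xz i); rewrite (negPf neqi) => /negbFE/eqP xyi /negbFE/eqP xzi.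
  by rewrite -xyi -xzi.
move=> neq /=; rewrite leq_min half //= adj_countC half // eq_sym.
by [].
Qed.

(* Lindsey's edge-isoperimetric inequality, the edges being counted in both
   orientations: slice [S] along a coordinate on which it is not constant. *)
Lemma adj_count_cube3_le (n : nat) (S : {set cube3 n}) :
  adj_count S S <= 2 * lex_edges #|S|.
Proof.
have [N] := ubnP #|S|; elim: N => // N IHN in S *; rewrite ltnS => leN.
have [small | big] := leqP #|S| 1.
  rewrite /adj_count big1 // => u uS; rewrite big1 // => v vS.
  by rewrite (card_le1_eqP small v u vS uS) adj_irrefl.
have [x [y [xS yS neq]]] := card_gt1P big.
have [j neqj] : exists j, (x : {ffun _ -> _}) j != (y : {ffun _ -> _}) j.
  apply/existsP; apply: contraNT neq => /existsPn xy; apply/eqP/ffunP => j.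
  by apply/eqP; move: (xy j); rewrite negbK.
pose slice c := [set x in S | (x : {ffun _ -> _}) j == c].
have slice_lt c : #|slice c| < #|S|.
  apply: proper_card; apply/properP; split.
    by apply/subsetP => z; rewrite inE => /andP[].
  have [xc | xc] := eqVneq ((x : {ffun _ -> _}) j) c.
    by exists y => //; rewrite inE yS /= -xc eq_sym.
  by exists x => //; rewrite inE xS.
have split_sum (F : cube3 n -> nat) : \sum_(u in S) F u = \sum_c \sum_(u in slice c) F u.
  rewrite (partition_big (fun u : cube3 n => (u : {ffun _ -> _}) j) xpredT) //=.
  by apply: eq_bigr => c _; apply: eq_bigl => u; rewrite inE.
have -> : adj_count S S = \sum_c \sum_c' adj_count (slice c) (slice c').
  rewrite /adj_count split_sum; apply: eq_bigr => c _.
  by rewrite [RHS]exchange_big /=; apply: eq_bigr => u _; rewrite split_sum.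
have -> : #|S| = \sum_c #|slice c|.
  by rewrite -sum1_card split_sum; apply: eq_bigr => c _; rewrite sum1_card.
have IH c : adj_count (slice c) (slice c) <= 2 * lex_edges #|slice c|.
  by apply: IHN; apply: leq_trans (slice_lt c) leN.
have cross c c' := @adj_count_slices n j c c' S.
rewrite !sum_ord3; set c0 := ord0; set c1 := Ordinal _; set c2 := Ordinal _.
(* The three minima bounding the edges between slices are exactly those of the superadditivity
   inequality. *)
have := lex_edges_superadd #|slice c0| #|slice c1| #|slice c2|.
move: (IH c0) (IH c1) (IH c2) (cross c0 c1 isT) (cross c1 c2 isT) (cross c0 c2 isT).
rewrite (adj_countC (slice c1) (slice c0)) (adj_countC (slice c2) (slice c1)).
rewrite (adj_countC (slice c2) (slice c0)) /= -/(slice c0) -/(slice c1) -/(slice c2).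
rewrite !addnA; lia.
Qed.

(** * Lower bound *)

Lemma adj_countE (G : sgraph) (A B : {set G}) :
  adj_count A B = \sum_(u : G) \sum_(v | adj u v) ((u \in A) && (v \in B)).
Proof.
rewrite /adj_count big_mkcond; apply: eq_bigr => u _.
case: (u \in A) => /=; last by rewrite big1.
rewrite big_mkcond [RHS]big_mkcond; apply: eq_bigr => v _.
by case: (v \in B); case: (adj u v).
Qed.

Lemma sum_adj_count (G : sgraph) (I : finType) (A B : I -> {set G}) :
  \sum_i adj_count (A i) (B i) =
  \sum_(u : G) \sum_(v | adj u v) \sum_i ((u \in A i) && (v \in B i)).
Proof.
under eq_bigr => i _ do rewrite adj_countE.
by rewrite exchange_big; apply: eq_bigr => u _; rewrite exchange_big.
Qed.

(** The degrees over [S] sum to [2 * n * #|S|], counting each boundary edge once and each inner edge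
    twice; Lindsey's inequality bounds the latter. *)
Lemma cube3_boundary_ge (n : nat) (S : {set cube3 n}) :
  2 * n * #|S| <= adj_count S (~: S) + 2 * lex_edges #|S|.
Proof.
apply: leq_trans (leq_add (leqnn _) (adj_count_cube3_le S)).
rewrite /adj_count -big_split /= mulnC -sum_nat_const; apply: leq_sum => u _.
rewrite -(cube3_degree u) (bigID [in S]) /= addnC.
apply: eq_leq; congr (_ + _); rewrite big_mkcond [RHS]big_mkcond;
  apply: eq_bigr => v _; rewrite ?inE;
  by case: (v \in S); case: (cube3_adj u v).
Qed.

Lemma sum_cut (m a b : nat) :
  b < m -> \sum_(k < m) ((a < k) && ~~ (b < k)) = b - a.
Proof.
(* The right-hand side is put in a form valid for all [m], to allow induction on [m]. *)
move=> lt_bm; have -> : b - a = minn m b.+1 - a.+1 by lia.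
elim: m {lt_bm} => [|m IHm]; first by rewrite big_ord0; lia.
by rewrite big_ord_recr /= IHm; lia.
Qed.

(** When the columns differ, only the column of [u] separates [u] from [v] in that order. The two
    truncated row differences count the row cuts crossed in either direction, and symmetry of
    adjacency merges them into the factor 2. *)
Lemma sum_cyl_dist (G : sgraph) (m : nat) (f : G -> 'I_3 * 'I_m) :
  \sum_(u : G) \sum_(v | adj u v) cyl_dist (f u) (f v) =
  \sum_c adj_count [set u | (f u).1 == c] (~: [set u | (f u).1 == c]) +
  2 * \sum_(k < m) adj_count [set u | (f u).2 < k] (~: [set u | (f u).2 < k]).
Proof.
have sym_cut : \sum_(k < m) adj_count [set u | (f u).2 < k] (~: [set u | (f u).2 < k])
    = \sum_(k < m) adj_count (~: [set u | (f u).2 < k]) [set u | (f u).2 < k].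
  by apply: eq_bigr => k _; rewrite adj_countC.
rewrite mul2n -addnn {2}sym_cut !sum_adj_count -!big_split /=.
apply: eq_bigr => u _; rewrite -!big_split /=; apply: eq_bigr => v _.
rewrite /cyl_dist (addnC (_ - _)); congr (_ + (_ + _)).
- rewrite (bigD1 (f u).1) //= !inE eqxx eq_sym big1 ?addn0 // => c.
  by rewrite !inE eq_sym => /negPf->.
- by rewrite -(sum_cut _ (ltn_ord (f v).2)); apply: eq_bigr => k _; rewrite !inE.
- rewrite -(sum_cut _ (ltn_ord (f u).2)); apply: eq_bigr => k _.
  by rewrite !inE andbC.
Qed.

Lemma wirelength_cube3_ge (p : nat)
    (f : embedding (cube3 p.+1) (cylinder (3 ^ p))) :
  3 ^ p * (2 * (3 ^ p - 1) + 3) <= wirelength f.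
Proof.
have := wirelength_cyl_ge f; set m := 3 ^ p.
rewrite (sum_cyl_dist (fun u => emb_map f u)).
have bij_f := emb_bij f.
have card_pre (P : pred ('I_3 * 'I_m)) : #|[set u | P (emb_map f u)]| = #|P|.
  have -> : [set u | P (emb_map f u)] = emb_map f @^-1: [set x | P x].
    by apply/setP => u; rewrite !inE.
  by rewrite on_card_preimset ?cardsE //; case: bij_f => g fK gK;
     exists g => x _; rewrite ?fK ?gK.
set cols := \sum_c _; set rows := \sum_(k < m) _.
(* Each of the three columns has [m] vertices, and at least [2 * p.+1 * m - 2 * (p * m) = 2 * m]
   edges leave it. *)
have cols_ge : 6 * m <= cols.
  rewrite /cols -[6]/(3 * 2) -mulnA -{1}[3]card_ord -sum_nat_const.
  apply: leq_sum => c _.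
  have := cube3_boundary_ge [set u | (emb_map f u).1 == c].
  rewrite (card_pre [pred x | x.1 == c]).
  have -> : #|[pred x : 'I_3 * 'I_m | x.1 == c]| = m.
    rewrite (eq_card (B := [predX pred1 c & predT])) ?cardX ?card1 ?card_ord ?mul1n //.
    by move=> x; rewrite !inE andbT.
  rewrite lex_edges_exp3 -/m -[2 * m](addnK (2 * (p * m))) leq_subLR addnC.
  by apply: leq_trans; lia.
(* The [3 * k] vertices in rows below [k] have at least [6 * p * k - 6 * lex_edges k] edges leaving
   them; [key] sums these bounds. *)
have rows_ge : 2 * (m * (m - 1)) <= rows.
  have key := sum_lex_edges_exp3 p; rewrite -/m in key.
  suff: 6 * p * (\sum_(k < m) k) <= rows + 6 * (\sum_(k < m) lex_edges k) by lia.
  rewrite /rows !big_distrr /= -big_split /=; apply: leq_sum => k _.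
  have := cube3_boundary_ge [set u | (emb_map f u).2 < k].
  rewrite (card_pre [pred x : 'I_3 * 'I_m | x.2 < k]).
  have -> : #|[pred x : 'I_3 * 'I_m | x.2 < k]| = 3 * k.
    rewrite (eq_card (B := [predX predT & [pred i : 'I_m | i < k]])); last first.
      by move=> x; rewrite !inE.
    rewrite cardX card_ord; congr (_ * _).
    rewrite -sum1_card (big_ord_narrow (ltnW (ltn_ord k))) /=.
    by rewrite sum1_card card_ord.
  rewrite lex_edges_mul3 => bd; rewrite -(leq_add2r (6 * k)).
  have bd' : 6 * p * k + 6 * k <= 2 * p.+1 * (3 * k) by lia.
  apply: leq_trans (leq_trans bd' bd) _.
  by rewrite -addnA leq_add2l; lia.
(* [cols + 2 * rows] is at least [6 * m + 4 * (m * (m - 1))], twice the claimed value. *)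
by rewrite mulnDr; nia.
Qed.

(** * The lexicographic embedding *)

Definition rank3 (p : nat) (x : 'I_p -> 'I_3) : nat := \sum_(j < p) x j * 3 ^ j.

Lemma rank3S (p : nat) (x : 'I_p.+1 -> 'I_3) :
  rank3 x = rank3 (fun j => x (lift ord0 j)) * 3 + x ord0.
Proof.
rewrite /rank3 big_ord_recl expn0 muln1 addnC big_distrl; congr (_ + _).
by apply: eq_bigr => j _; rewrite /= /bump add1n expnS mulnAC mulnA.
Qed.

Lemma rank3_lt (p : nat) (x : 'I_p -> 'I_3) : rank3 x < 3 ^ p.
Proof.
elim: p x => [|p IHp] x; first by rewrite /rank3 big_ord0.
rewrite rank3S expnS; have := IHp (fun j => x (lift ord0 j)).
by move: (rank3 _) (ltn_ord (x ord0)) => r; lia.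
Qed.

Lemma rank3_inj (p : nat) (x y : 'I_p -> 'I_3) : rank3 x = rank3 y -> x =1 y.
Proof.
elim: p x y => [|p IHp] x y; first by move=> _ [].
rewrite !rank3S => eq_xy.
have [lt_x lt_y] := (ltn_ord (x ord0), ltn_ord (y ord0)).
have eq0 : x ord0 = y ord0 by apply: val_inj => /=; lia.
have /IHp eqS : rank3 (fun j => x (lift ord0 j)) = rank3 (fun j => y (lift ord0 j)).
  by lia.
move=> i; case: (unliftP ord0 i) => [j ->|->] //; exact: eqS.
Qed.

Definition lex_map (p : nat) (x : {ffun 'I_p.+1 -> 'I_3}) : 'I_3 * 'I_(3 ^ p) :=
  (x ord0, Ordinal (rank3_lt (fun j => x (lift ord0 j)))).

Lemma lex_map_bij (p : nat) : bijective (@lex_map p).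
Proof.
apply: inj_card_bij => [x y [eq0 /rank3_inj eqS]|].
  by apply/ffunP => i; case: (unliftP ord0 i) => [j ->|->]; rewrite ?eq0 ?eqS.
by rewrite card_prod card_ffun !card_ord expnS.
Qed.

Lemma cyl_dist_lex_upd0 (p : nat) (x : {ffun 'I_p.+1 -> 'I_3}) (c : 'I_3) :
  c != x ord0 -> cyl_dist (lex_map x) (lex_map (ffun_upd x ord0 c)) = 1.
Proof.
move=> neq; rewrite /cyl_dist /= ffunE eqxx eq_sym neq.
suff -> : rank3 (fun j => ffun_upd x ord0 c (lift ord0 j)) =
    rank3 (fun j => x (lift ord0 j)) by rewrite subnn.
by apply: eq_bigr => j _; rewrite ffunE.
Qed.

(** The other digits cancel in the difference of the two ranks, leaving the change in the digit of
    weight [3 ^ i]. *)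
Lemma cyl_dist_lex_updS (p : nat) (x : {ffun 'I_p.+1 -> 'I_3}) (i : 'I_p) (c : 'I_3) :
  cyl_dist (lex_map x) (lex_map (ffun_upd x (lift ord0 i) c)) =
  (x (lift ord0 i) - c + (c - x (lift ord0 i))) * 3 ^ i.
Proof.
rewrite /cyl_dist /= ffunE /= eqxx add0n /rank3 (bigD1 i) //=.
rewrite [X in _ - X + _](bigD1 i) // [X in _ + (X - _)](bigD1 i) //= ffunE eqxx.
rewrite [X in _ - (_ + X)](eq_bigr (fun j => x (lift ord0 j) * 3 ^ j)) => [|j neq].
  rewrite [X in _ + (_ + X - _)](eq_bigr (fun j => x (lift ord0 j) * 3 ^ j)) => [|j neq].
    by rewrite !subnDr mulnDl !mulnBl.
  by rewrite ffunE (inj_eq (@lift_inj _ _)) (negPf neq).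
by rewrite ffunE (inj_eq (@lift_inj _ _)) (negPf neq).
Qed.

Lemma sum_ffun_coord (p : nat) (j : 'I_p.+1) (g : 'I_3 -> nat) :
  \sum_(x : {ffun 'I_p.+1 -> 'I_3}) g (x j) = 3 ^ p * \sum_a g a.
Proof.
(* [g (x j)] becomes a product over all coordinates, so the sum over functions factors; the other
   [p] coordinates contribute 3 each. *)
pose F (i : 'I_p.+1) (a : 'I_3) := if i == j then g a else 1.
transitivity (\sum_(x : {ffun 'I_p.+1 -> 'I_3}) \prod_i F i (x i)).
  apply: eq_bigr => x _; rewrite (bigD1 j) //= /F eqxx big1 ?muln1 // => i.
  by move=> /negPf->.
rewrite -bigA_distr_bigA (bigD1 j) //= /F eqxx mulnC; congr (_ * _).
rewrite (eq_bigr (fun=> 3)) => [|i /negPf->]; last by rewrite sum1_card card_ord.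
by rewrite prod_nat_const cardC1 card_ord.
Qed.

Lemma sum_cyl_dist_lex (p : nat) :
  \sum_(x : cube3 p.+1) \sum_(y | adj x y) cyl_dist (lex_map x) (lex_map y) =
  2 * (3 ^ p * (2 * (3 ^ p - 1) + 3)).
Proof.
pose g (a : 'I_3) := \sum_(c | c != a) ((a - c) + (c - a)).
(* Of the six ordered pairs of distinct digits, four differ by 1 and two by 2. *)
have sum_g : \sum_a g a = 8.
  have gE a : g a = \sum_(c < 3) ((a - c) + (c - a)).
    by rewrite [RHS](bigD1 a) //= subnn.
  by rewrite sum_ord3 !gE !sum_ord3.
(* The 2 comes from the two changes of coordinate 0, each of length one; the inner sum from the
   changes of a row digit. *)
transitivity (\sum_(x : {ffun 'I_p.+1 -> 'I_3})
    (2 + \sum_(i < p) g (x (lift ord0 i)) * 3 ^ i)).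
  apply: eq_bigr => x _; rewrite (sum_cube3_adj x (fun y => cyl_dist (lex_map x) (lex_map y))).
  rewrite big_ord_recl; congr (_ + _).
    apply: etrans (sum_neq3 (x ord0)); apply: eq_bigr => c.
    exact: cyl_dist_lex_upd0.
  apply: eq_bigr => i _; rewrite big_distrl; apply: eq_bigr => c _.
  exact: cyl_dist_lex_updS.
rewrite big_split /= sum_nat_const card_ffun !card_ord exchange_big /=.
rewrite (eq_bigr (fun i : 'I_p => 8 * 3 ^ p * 3 ^ i)) => [|i _]; last first.
  by rewrite -big_distrl /= sum_ffun_coord sum_g [8 * _]mulnC.
rewrite -big_distrr /= expnS.
have : 2 * (\sum_(i < p) 3 ^ i) = 3 ^ p - 1.
  elim: p {g sum_g} => [|p IHp]; first by rewrite big_ord0.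
  by rewrite big_ord_recr /= expnS mulnDr IHp; have := expn_gt0 3 p; lia.
by move: (\sum_(i < p) _) (3 ^ p) => t m; nia.
Qed.

Theorem theorem4p5 (n : nat) (hn : 2 <= n) :
  min_wirelength_is (cube3 n)
    (cart_prod (cycle_graph 3) (path_graph (3 ^ (n - 1))))
    (3 ^ (n - 1) * (2 * (3 ^ (n - 1) - 1) + 3)).
Proof.
case: n hn => // p _; rewrite subn1; split; last exact: wirelength_cube3_ge.
have [phi] := @wirelength_cyl_attained (cube3 p.+1) (3 ^ p) (@lex_map p) (@lex_map_bij p).
rewrite sum_cyl_dist_lex => /eqP; rewrite eqn_pmul2l // => /eqP phi_wl.
by exists phi.
Qed.
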